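(* Let $k_1=k_2=k_3,\lambda_1,\lambda_2,f$ be positive constants, $0<\theta_0<\pi/2$, and let $q=\frac{2\pi n_0}{h}$ for a fixed positive integer $n_0$. Assume $\delta\rho=t\sin(qz)$ with $t\ge0$, and consider the energy $F(\theta)=F(\theta,t\sin(qz))$ of the context as a functional of $\theta$. Then: (i) $\theta\equiv0$ is a critical point for every $t\ge0$; (ii) $\theta\equiv0$ (the helical smectic phase) is stable for $$t<t_1=\sqrt{\frac{k_1\sigma^2}{2\lambda_2q^4\cos^2\theta_0}},$$ but unstable for $$t>t_2=\sqrt{\frac{2qh\,k_1\sigma^2}{(2qh-\sin(2qh))\lambda_2q^4\cos^2\theta_0}};$$ (iii) among constant functions $\theta$, the energy-minimizing value (optimal twist plane) is $$\theta^*\equiv\arcsin\sqrt{\max\left(\cos^2\theta_0-\frac{k_1h\sigma^2}{\lambda_2t^2q^4\left(h-\frac{\sin(2qh)}{2q}\right)},\,0\right)}$$ (as a minimizer over constants in $[-\pi/2,\pi/2]$, up to the symmetry $\theta\mapsto-\theta$ of the energy; for $t=0$ the maximum is read as $0$).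
   Context: Let $h>0$, $\sigma=2\pi/p>0$ ($p>0$ the pitch), and $d\in\mathbb R$ a fixed constant. When $k_1=k_2=k_3$ the energy is $$F(\theta,\delta\rho)=\int_0^h\Big\{k_1\theta_z^2-k_1\sigma^2\cos^2\theta+\tfrac d2\delta\rho^2+\tfrac f4\delta\rho^4+\lambda_1(\delta\rho_{zz}+q^2\delta\rho)^2+\lambda_2\big(\sin^2\theta\,\delta\rho_{zz}+q^2\delta\rho\cos^2\theta_0\big)^2\Big\}\,dz,$$ for $\theta\in W^{1,2}(0,h)$ with values in $[-\pi/2,\pi/2]$ and natural (Neumann) conditions $\theta_z(0)=\theta_z(h)=0$. The second variation of $F(\theta)=F(\theta,t\sin(qz))$ at $\theta\equiv0$ is $\delta^2F(\eta)=\frac{d^2}{d\varepsilon^2}\big|_{\varepsilon=0}F(\varepsilon\eta,t\sin(qz))$; $\theta\equiv0$ is called stable if $\inf_{\eta\in W^{1,2}(0,h)\setminus\{0\}}\delta^2F(\eta)/\int_0^h\eta^2\,dz>0$ and unstable if this infimum is negative. *)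

(* Defs.v *)
From mathcomp Require Import all_boot all_order all_algebra.
From mathcomp Require Import all_classical all_reals all_analysis.
Import Order.TTheory GRing.Theory Num.Theory.
Import numFieldNormedType.Exports.
Set Implicit Arguments.
Unset Strict Implicit.
Unset Printing Implicit Defensive.

Local Open Scope ring_scope.
Local Open Scope classical_set_scope.

(* Elements of L^2(0,h) and W^{1,2}(0,h) are represented by functions R -> R
   whose values outside ]0, h[ are irrelevant. *)

Definition int0 {R : realType} (h : R) (u : R -> R) : R :=
  \int[lebesgue_measure]_(z in `]0, h[) u z.

Definition L2 {R : realType} (h : R) (u : R -> R) : Prop :=
  measurable_fun `]0, h[ u /\
  (@lebesgue_measure R).-integrable `]0, h[ (fun z => (u z ^+ 2)%:E).

(* phi is in C_c^oo(0,h). *)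
Definition test_function {R : realType} (h : R) (phi : R -> R) : Prop :=
  (forall (n : nat) (z : R), derivable (phi^`(n))%classic z 1) /\
  (exists a b : R, [/\ 0 < a, b < h &
     forall z : R, ~~ (a <= z <= b) -> phi z = 0]).

Definition is_weak_deriv {R : realType} (h : R) (u g : R -> R) : Prop :=
  forall phi : R -> R, test_function h phi ->
    int0 h (fun z => u z * (phi^`())%classic z) = - int0 h (fun z => g z * phi z).

Definition W12 {R : realType} (h : R) (u : R -> R) : Prop :=
  L2 h u /\ exists g : R -> R, L2 h g /\ is_weak_deriv h u g.

(* A choice of weak derivative in L^2(0,h), determined up to a null set when u
   is in W^{1,2}(0,h). *)
Definition weak_deriv {R : realType} (h : R) (u : R -> R) : R -> R :=
  xget (cst 0) [set g : R -> R | L2 h g /\ is_weak_deriv h u g].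

Definition ae_null {R : realType} (h : R) (u : R -> R) : Prop :=
  {ae @lebesgue_measure R, forall z : R, 0 < z < h -> u z = 0}.

(* k1 is the common value of the three elastic constants. The derivative of
   theta is the weak one. The derivative of rho is classical: the density
   modulation is always a smooth function here. *)
Definition energy {R : realType} (k1 sigma d f lambda1 lambda2 theta0 q h : R)
    (theta rho : R -> R) : R :=
  int0 h (fun z =>
    k1 * weak_deriv h theta z ^+ 2 - k1 * sigma ^+ 2 * cos (theta z) ^+ 2
    + d / 2 * rho z ^+ 2 + f / 4 * rho z ^+ 4
    + lambda1 * ((rho^`(2))%classic z + q ^+ 2 * rho z) ^+ 2
    + lambda2 * (sin (theta z) ^+ 2 * (rho^`(2))%classic z
                 + q ^+ 2 * rho z * cos theta0 ^+ 2) ^+ 2).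

Definition admissible {R : realType} (h : R) (theta : R -> R) : Prop :=
  W12 h theta /\
  {ae @lebesgue_measure R, forall z : R, 0 < z < h ->
     - (pi / 2) <= theta z <= pi / 2}.

(* Variations are not constrained at the endpoints, so the vanishing of the
   first variation encodes both the Euler-Lagrange equation and the natural
   conditions theta_z(0) = theta_z(h) = 0. *)
Definition critical_point {R : realType} (h : R) (F : (R -> R) -> R)
    (theta : R -> R) : Prop :=
  admissible h theta /\
  forall eta : R -> R, W12 h eta ->
    is_derive (0 : R) (1 : R) (fun eps : R => F (fun z => theta z + eps * eta z))
      (0 : R).

(* Second variation at theta = 0. *)
Definition second_variation {R : realType} (F : (R -> R) -> R) (eta : R -> R)
    : R :=
  (fun eps : R => F (fun z => eps * eta z))^`(2)%classic 0.

Definition rayleigh_inf {R : realType} (h : R) (F : (R -> R) -> R) : \bar R :=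
  ereal_inf [set (second_variation F eta / int0 h (fun z => eta z ^+ 2))%:E
            | eta in [set eta : R -> R | W12 h eta /\ ~ ae_null h eta]].

Definition zero_stable {R : realType} (h : R) (F : (R -> R) -> R) : Prop :=
  (0 < rayleigh_inf h F)%E.

Definition zero_unstable {R : realType} (h : R) (F : (R -> R) -> R) : Prop :=
  (rayleigh_inf h F < 0)%E.

(* Constants c in [-pi/2, pi/2] minimizing F among all such constants. *)
Definition constant_minimizers {R : realType} (F : (R -> R) -> R) : set R :=
  [set c : R | - (pi / 2) <= c <= pi / 2 /\
     forall c' : R, - (pi / 2) <= c' <= pi / 2 -> F (cst c) <= F (cst c')].

(* The case t = 0 is separated because x / 0 = 0 in a field. *)
Definition theta_opt {R : realType} (k1 sigma lambda2 theta0 q h t : R) : R :=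
  asin (Num.sqrt (if t == 0 then 0 else
    Num.max (cos theta0 ^+ 2
             - k1 * h * sigma ^+ 2 /
               (lambda2 * t ^+ 2 * q ^+ 4 * (h - sin (2 * q * h) / (2 * q))))
            0)).

(* Main.v *)
Require Import Defs.
From mathcomp Require Import all_boot all_order all_algebra.
From mathcomp Require Import all_classical all_reals all_analysis.
From mathcomp Require Import measurable_realfun ring lra.
Import Order.TTheory GRing.Theory Num.Theory.
Import numFieldNormedType.Exports.
Local Open Scope ring_scope.
Local Open Scope classical_set_scope.

(* Along a line x |-> x eta through theta = 0, the density modulation reduces
   the energy density to k1 x^2 eta_z^2 + W(z, x eta) + b(z), where
   W(z, s) = - k1 sigma^2 cos^2 s + c(z) (cos^2 theta0 - sin^2 s)^2 and
   c(z) = lambda2 q^4 t^2 sin^2(q z). As W(z, .) has bounded first and second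
   derivatives, W_s(z, 0) = 0 and
   W_ss(z, 0) = 2 (k1 sigma^2 - 2 c(z) cos^2 theta0),
   differentiating twice under the integral sign shows that theta = 0 is critical
   and that the second variation is
   2 int (k1 eta_z^2 + (k1 sigma^2 - 2 c(z) cos^2 theta0) eta^2).
   The bound c <= lambda2 q^4 t^2 gives stability below t1; eta = 1 gives
   instability above t2, as sin^2(q z) has mean 1/2 over whole periods. On
   constants the energy is a quadratic polynomial in sin^2 theta.
   The energy involves an arbitrary choice of weak derivative, so uniqueness of
   weak derivatives is needed; it is obtained by testing against smooth bumps that
   increase to the indicator function of ]0, b[. *)

(** * Smooth bumps *)

Section smooth_bumps.
Context {R : realType}.
Implicit Types (k n : nat) (x : R) (P Q : {poly R}).

(** Derivatives of the flat function e^(-1/x), extended by 0 to x <= 0, are combinations of terms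
    x^(-k) e^(-1/x), so all [k] are treated at once. *)
Definition expinv k x : R := if 0 < x then x^-1 ^+ k * expR (- x^-1) else 0.

Lemma expinv_ge0 k x : 0 <= expinv k x.
Proof.
rewrite /expinv; case: ifPn => // x0.
by rewrite mulr_ge0 ?expR_ge0// exprn_ge0// invr_ge0 ltW.
Qed.

(** This is e^y >= 1 + y^(k+1)/(k+1)! at y = 1/x. The linear decay yields continuity at 0. *)
Lemma expinv_le k x : expinv k x <= k.+1`!%:R * `|x|.
Proof.
rewrite /expinv; case: ifPn => [x0|_]; last by rewrite mulr_ge0.
rewrite gtr0_norm// expRN ler_pdivrMr ?expR_gt0// -ler_pdivrMl; last first.
  by rewrite mulr_gt0// ltr0n fact_gt0.
have := @expR_ge1Dxn R x^-1 k; rewrite invr_ge0 (ltW x0) => /(_ isT).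
apply: le_trans; rewrite invfM -mulrA -exprS mulrC lerDr.
by rewrite ler01.
Qed.

Lemma is_derive_expinv k x :
  is_derive x 1 (expinv k) (expinv k.+2 x - k%:R * expinv k.+1 x).
Proof.
have [x0|x0|->] := ltgtP x 0.
- rewrite /expinv ltNge (ltW x0)/= mulr0 subr0.
  apply: (@near_eq_is_derive _ _ _ (cst 0)).
  near=> y; rewrite /expinv ifF//.
  by apply/negbTE; rewrite -leNgt ltW//; near: y; exact: lt_nbhsl.
- apply: (@near_eq_is_derive _ R^o R^o (fun y : R => y^-1 ^+ k * expR (- y^-1))).
    by near=> y; rewrite /expinv ifT//; near: y; exact: lt_nbhsr.
  have xn0 : x != 0 by rewrite gt_eqF.
  rewrite /expinv x0.
  have -> : (fun y : R => y^-1 ^+ k * expR (- y^-1)) =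
      (fun y => y^-1) ^+ k * (expR \o (- (fun y => y^-1))).
    by apply/funext => y; rewrite !fctE.
  have dV : is_derive x 1 (fun y : R => y^-1) (- x ^- 2).
    by apply: trigger_derive; first exact: is_deriveV; rewrite scaler1.
  apply: trigger_derive.
  rewrite !fctE /GRing.scale/=.
  by rewrite -!exprVn; case: k => [|k]; rewrite ?mulr0n/= ?exprS; ring.
- rewrite /expinv ltxx mulr0 subr0; apply/is_derive1_caratheodory.
  (* The difference quotient of [expinv k] at 0 is [expinv k.+1], and it tends to 0 by
     [expinv_le]. *)
  exists (expinv k.+1); split.
  + move=> z; rewrite subr0 /expinv ltxx subr0; case: ifPn => z0.
      by rewrite exprS; field; rewrite gt_eqF.
    by rewrite mul0r.
  + apply/cvgrPdist_le => e e0.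
    have : 0 < k.+2`!%:R^-1 * e by rewrite mulr_gt0// invr_gt0 ltr0n fact_gt0.
    move/(@nbhs0_le _ R^o); apply: filterS => y ye.
    rewrite {1}/expinv ltxx sub0r normrN ger0_norm ?expinv_ge0//.
    apply: le_trans (expinv_le _ _) _.
    by rewrite -ler_pdivlMl ?ltr0n ?fact_gt0.
  + by rewrite /expinv ltxx.
Unshelve. all: by end_near. Qed.

(* This class of functions is closed under differentiation, so that smoothness
   reduces to first-order derivability. *)
Inductive expinv_combination Q : (R -> R) -> Prop :=
| expinv_term P k : expinv_combination Q (fun x => P.[x] * expinv k Q.[x])
| expinv_add u v : expinv_combination Q u -> expinv_combination Q v ->
    expinv_combination Q (fun x => u x + v x).

(** With E_k for [expinv k], the product and chain rules turn P E_k(Q) into P' E_k(Q) + P Q'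
    E_(k+2)(Q) - k P Q' E_(k+1)(Q). *)
Lemma is_derive_expinv_combination Q u : expinv_combination Q u ->
  exists2 v, expinv_combination Q v & forall x, is_derive x 1 u (v x).
Proof.
elim => {u}[P k|u1 u2 _ [v1 cv1 dv1] _ [v2 cv2 dv2]]; last first.
  exists (fun x => v1 x + v2 x); first exact: expinv_add.
  by move=> x; exact: is_deriveD.
exists (fun x => P^`().[x] * expinv k Q.[x] +
    ((P * Q^`()).[x] * expinv k.+2 Q.[x] +
     (- k%:R *: (P * Q^`())).[x] * expinv k.+1 Q.[x])).
  by do 2![apply: expinv_add; first exact: expinv_term]; exact: expinv_term.
move=> x.
have dP := is_derive_poly P x; have dQ := is_derive_poly Q x.
have dE := is_derive_expinv k Q.[x].
have dEQ := @is_derive1_comp _ _ _ _ _ _ dE dQ.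
have -> : (fun y => P.[y] * expinv k Q.[y]) = horner P * (expinv k \o horner Q).
  by apply/funext => y; rewrite !fctE.
apply: trigger_derive.
by rewrite /GRing.scale/= hornerZ hornerM; ring.
Qed.

Lemma expinv_combination_derive1n Q u n :
  expinv_combination Q u -> expinv_combination Q (u^`(n))%classic.
Proof.
move=> cu; elim: n => [//|n IHn]; rewrite derive1nS.
have [v cv dv] := is_derive_expinv_combination Q _ IHn.
suff -> : (u^`(n)^`())%classic = v by [].
by apply/funext => x; rewrite derive1E; exact: derive_val.
Qed.

(** Subtracting 1 keeps the support compact inside ]0, b[; the factor n + 1 sends the argument to
    +oo at each interior point, where the bump then tends to 1. *)
Definition bump n b x : R := expinv 0 (n.+1%:R * (x * (b - x)) - 1).

Lemma bump_ge0 n b x : 0 <= bump n b x.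
Proof. exact: expinv_ge0. Qed.

Lemma bump_le1 n b x : bump n b x <= 1.
Proof.
rewrite /bump /expinv; case: ifPn => // x0.
by rewrite expr0 mul1r expR_le1 oppr_le0 invr_ge0 ltW.
Qed.

Lemma bump_eq0 n b x : x * (b - x) <= n.+1%:R^-1 -> bump n b x = 0.
Proof.
rewrite -[n.+1%:R^-1]mulr1 -ler_pdivrMl ?invr_gt0 ?ltr0n// invrK => xb.
by rewrite /bump /expinv ifF//; apply/negbTE; rewrite -leNgt subr_le0.
Qed.

Lemma test_function_bump h n b : 0 < b <= h -> test_function h (bump n b).
Proof.
move=> /andP[b0 bh]; split.
  pose Q : {poly R} := n.+1%:R *: ('X * (b%:P - 'X)) - 1%:P.
  have cb : expinv_combination Q (bump n b).
    rewrite (_ : bump n b = fun x => (1%:P : {poly R}).[x] * expinv 0 Q.[x]).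
      exact: expinv_term.
    by apply/funext => x; rewrite /bump !hornerE.
  move=> m z; have [v _ dv] :=
    is_derive_expinv_combination Q _ (expinv_combination_derive1n Q _ m cb).
  exact: ex_derive.
have n0 : (0 : R) < n.+1%:R^-1 by rewrite invr_gt0 ltr0n.
(* Where the bump is nonzero, z (b - z) > 1/(n+1). Since z (b - z) is at most both b z and b (b -
   z), the point z lies at distance at least 1/((n+1) b) from 0 and from b. *)
exists (n.+1%:R^-1 / b), (b - n.+1%:R^-1 / b); split.
- by rewrite divr_gt0.
- by rewrite (lt_le_trans _ bh)// ltrBlDr ltrDl divr_gt0.
move=> z; apply: contraNeq; rewrite ler_pdivrMr// lerBrDr -lerBrDl ler_pdivrMr//.
move/eqP => z0; have {z0} : n.+1%:R^-1 < z * (b - z).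
  by rewrite ltNge; apply/negP => /bump_eq0.
move=> nz; apply/andP; split; apply/ltW/(lt_le_trans nz); rewrite -subr_ge0.
  by rewrite (_ : _ - _ = z ^+ 2) ?sqr_ge0//; ring.
by rewrite (_ : _ - _ = (b - z) ^+ 2) ?sqr_ge0//; ring.
Qed.

Lemma bump_cvg b x : 0 < x < b -> bump n b x @[n --> \oo] --> (1 : R).
Proof.
move=> /andP[x0 xb]; have xbx : 0 < x * (b - x) by rewrite mulr_gt0// subr_gt0.
have y_cvg : n.+1%:R * (x * (b - x)) - 1 @[n --> \oo] --> +oo.
  apply/cvgryPge => A; near=> n; rewrite lerBrDr -ler_pdivrMr//.
  rewrite (@le_trans _ _ n%:R) ?ler_nat//.
  near: n; exact: nbhs_infty_ger.
rewrite [X in _ --> X](_ : _ = expR (- 0)); last by rewrite oppr0 expR0.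
apply: cvg_trans
  (_ : expR (- (n.+1%:R * (x * (b - x)) - 1)^-1) @[n --> \oo] --> _).
  apply: near_eq_cvg; near=> n; rewrite /bump /expinv expr0 mul1r ifT//.
  near: n; move/cvgryPgt : y_cvg; exact.
suff c : - (n.+1%:R * (x * (b - x)) - 1)^-1 @[n --> \oo] --> (- 0 : R).
  exact: (cvg_comp _ _ c (@continuous_expR R (- 0))).
apply: cvgN; apply/gtr0_cvgV0 => //.
by move/cvgryPgt : y_cvg; exact.
Unshelve. all: by end_near. Qed.

End smooth_bumps.

(** * The fundamental lemma of the calculus of variations *)

Section fundamental_lemma.
Context {R : realType}.
Notation mu := (@lebesgue_measure R).
Variables (h : R).
Let D : set R := `]0, h[.

Lemma finite_measure_itv (a b : R) : (mu `]a, b[ < +oo)%E.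
Proof.
by rewrite lebesgue_measure_itv/=; case: ifPn => _; rewrite ?ltry// -EFinB ltry.
Qed.

Lemma integrable_bounded (u : R -> R) (C : R) : measurable_fun D u ->
  (forall z, D z -> `|u z| <= C) -> mu.-integrable D (EFin \o u).
Proof.
move=> mu_ uC; apply: measurable_bounded_integrable => //.
- exact: measurable_itv.
- exact: finite_measure_itv.
- exists C; split; first exact: num_real.
  by move=> M CM z Dz; rewrite /= (le_trans (uC _ Dz))// ltW.
Qed.

Lemma integrable_le (u v : R -> R) : measurable_fun D u ->
  (forall z, D z -> `|u z| <= v z) -> mu.-integrable D (EFin \o v) ->
  mu.-integrable D (EFin \o u).
Proof.
move=> mu_ uv; apply: le_integrable => //; first exact: measurable_itv.
  exact/measurable_EFinP.
by move=> z Dz; rewrite lee_fin (le_trans (uv _ Dz))// ler_norm.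
Qed.

Lemma integrable_measurable (u : R -> R) :
  mu.-integrable D (EFin \o u) -> measurable_fun D u.
Proof. by move=> /measurable_int /measurable_EFinP. Qed.

Lemma measurable_bump n (b : R) : 0 < b -> measurable_fun D (bump n b).
Proof.
move=> b0; apply: (@measurable_funS _ _ _ _ setT) => //.
apply: continuous_measurable_fun => z.
apply/differentiable_continuous/derivable1_diffP.
have [|dphi _] := test_function_bump b n b; first by rewrite b0 lexx.
exact: (dphi 0%N).
Qed.

(** Dominated convergence: the bumps lie in [0, 1] and tend to the indicator of ]0, b[, so [|u|]
    dominates the products. *)
Lemma integral_bump_eq0 (u : R -> R) (b : R) : 0 < b ->
  mu.-integrable D (EFin \o u) ->
  (forall n, int0 h (fun z => u z * bump n b z) = 0) ->
  \int[mu]_(z in D) (u \_ `]0, b[) z = 0.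
Proof.
move=> b0 iu u0; have mu_ := integrable_measurable _ iu.
have mD : measurable D by exact: measurable_itv.
have iub n : mu.-integrable D (EFin \o (fun z => u z * bump n b z)).
  apply: (integrable_le _ (fun z => `|u z|)).
  - by apply: measurable_funM => //; exact: measurable_bump.
  - move=> z Dz; rewrite normrM ler_piMr// ger0_norm ?bump_ge0//.
    exact: bump_le1.
  - exact: integrable_norm.
have [] := @dominated_convergence _ _ _ mu D mD
  (fun n z => (u z * bump n b z)%:E) (fun z => ((u \_ `]0, b[) z)%:E)
  (fun z => `|(EFin \o u) z|%E).
- by move=> n; apply/measurable_EFinP; exact: integrable_measurable (iub n).
- apply/measurable_EFinP; apply/(measurable_restrict _ _ _).1 => //.
  by apply: measurable_funS mu_ => //; exact: measurableI.
- apply: aeW => z Dz; apply: cvg_EFin; first exact: nearW.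
  have z0 : 0 < z by move: Dz; rewrite /D/= in_itv/= => /andP[].
  rewrite patchE; case: ifPn => [|].
    rewrite inE/= in_itv/= => zb; rewrite -[X in _ --> X]mulr1.
    by apply: cvgM; [exact: cvg_cst|exact: bump_cvg].
  rewrite notin_setE/= in_itv/= z0/= => /negP; rewrite -leNgt => bz.
  rewrite (_ : (fun n => _) = cst 0); first exact: cvg_cst.
  apply/funext => n; rewrite bump_eq0 ?mulr0//.
  rewrite (@le_trans _ _ 0) ?invr_ge0//.
  by rewrite pmulr_rle0// subr_le0.
- exact: integrable_abse.
- apply: aeW => z n Dz; rewrite /= lee_fin normrM ler_piMr//.
  by rewrite ger0_norm ?bump_ge0//; exact: bump_le1.
move=> _ _ cI; rewrite /Rintegral.
rewrite (_ : \int[mu]_(z in D) _ = 0)%E//; apply: (cvg_unique _ cI) => //.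
rewrite (_ : (fun n => _) = cst 0%E); first exact: cvg_cst.
apply/funext => n; have := u0 n; rewrite /int0 /Rintegral => un0.
by rewrite -[LHS]fineK ?un0//; apply: integrable_fin_num => //; exact: iub.
Qed.

(** All integrals of [u] over ]0, x[ with 0 < x < h vanish, so the primitive of the extension of [u]
    by 0 is zero near each such x. By Lebesgue differentiation its derivative is [u] almost
    everywhere. *)
Lemma ae_null_bump (u : R -> R) : mu.-integrable D (EFin \o u) ->
  (forall n b, 0 < b <= h -> int0 h (fun z => u z * bump n b z) = 0) ->
  ae_null h u.
Proof.
move=> iu u0; have mu_ := integrable_measurable _ iu.
have mD : measurable D by exact: measurable_itv.
have iuD : mu.-integrable setT (EFin \o (u \_ D)).
  rewrite -restrict_EFin.
  by have [+ _] := @integrable_mkcond _ _ _ mu D (EFin \o u) mD; exact.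
have F0 x : 0 < x < h -> \int[mu]_(t in `]-oo, x]) (u \_ D) t = 0.
  move=> /andP[x0 xh].
  rewrite -Rintegral_itv_bndo_bndc; last exact: integrableS iuD.
  rewrite -Rintegral_mkcondr.
  rewrite (_ : _ `&` D = D `&` `]0, x[); last first.
    apply/seteqP; split => z; rewrite /D /= !in_itv/=.
      by move=> [zx /andP[-> ->]]; rewrite zx.
    by move=> [/andP[-> ->] /andP[_ ->]].
  rewrite Rintegral_mkcondr integral_bump_eq0// => n.
  by apply: u0; rewrite x0 ltW.
have iuy y : mu.-integrable `]-oo, y] (EFin \o (u \_ D)).
  exact: integrableS iuD.
have /= := FTC1Ny iuy (integrable_locally mD iu).
apply: filterS; first exact: (ae_filter_ringOfSetsType mu).
move=> x + /andP[x0 xh] => -[_].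
rewrite patchE mem_set; last by rewrite /D/= in_itv/= x0.
move=> <-; rewrite derive1E (@near_eq_derive _ _ _ _ (cst 0)) ?derive_cst//.
near=> y; apply: F0; apply/andP; split; near: y.
- exact: lt_nbhsr.
- exact: lt_nbhsl.
Unshelve. all: by end_near. Qed.

End fundamental_lemma.

(** * Weak derivatives *)

Section weak_derivatives.
Context {R : realType}.
Notation mu := (@lebesgue_measure R).
Variables (h : R) (h_gt0 : 0 < h).
Let D : set R := `]0, h[.
Let mD : measurable D := measurable_itv _.

Lemma int0_FTC (u U : R -> R) : continuous u ->
  (forall z : R, is_derive z 1 U (u z)) -> int0 h u = U h - U 0.
Proof.
move=> cu dU.
have cU z : {for z, continuous U}.
  apply/differentiable_continuous/derivable1_diffP.
  by have [] := dU z.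
have iu : mu.-integrable `[0, h] (EFin \o u).
  apply: continuous_compact_integrable; first exact: segment_compact.
  exact: continuous_subspaceT.
rewrite /int0 Rintegral_itv_obnd_cbnd; last first.
  apply: integrableS iu => //.
  exact: subset_itv_oo_cc.
rewrite Rintegral_itv_bndo_bndc; last first.
  by apply: integrableS iu => //; exact: subset_itv_co_cc.
rewrite /Rintegral (@continuous_FTC2 _ u U)//.
- exact: continuous_subspaceT.
- split; [by move=> z _; have [] := dU z| |].
  + apply: cvg_at_right_filter; exact: cU.
  + apply: cvg_at_left_filter; exact: cU.
- by move=> z _; rewrite derive1E; have [] := dU z.
Qed.

Lemma L2_integrable (u : R -> R) : L2 h u -> mu.-integrable D (EFin \o u).
Proof.
(* The constant 1 is integrable because the interval is bounded. *)
move=> [mu_ iu2]; apply: (@integrable_le _ h _ (fun z => 1 + u z ^+ 2)) => //.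
  by move=> z _; rewrite ler_norml; apply/andP; split; nra.
apply: (@integrableD _ _ _ mu D mD (cst 1%:E) (fun z => (u z ^+ 2)%:E)) => //.
by apply: (@integrable_bounded _ h (cst 1) 1) => // z _; rewrite normr1.
Qed.

Lemma test_function_continuous (phi : R -> R) n :
  test_function h phi -> continuous (phi^`(n))%classic.
Proof.
by move=> [dphi _] z; apply/differentiable_continuous/derivable1_diffP.
Qed.

(** Continuity on the compact [0, h] bounds the derivative of the test function. Orders 0 and 1
    serve the two sides of the weak-derivative identity. *)
Lemma integrable_test (u phi : R -> R) n : mu.-integrable D (EFin \o u) ->
  test_function h phi ->
  mu.-integrable D (EFin \o (fun z => u z * (phi^`(n))%classic z)).
Proof.
move=> iu /(@test_function_continuous _ n); set psi := (phi^`(n))%classic => cpsi.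
have /EVT_max : {within `[0, h], continuous (fun z => `|psi z|)}.
  apply: continuous_subspaceT => z; apply: continuous_comp; first exact: cpsi.
  exact: norm_continuous.
move=> /(_ (ltW h_gt0)) [c _ cmax].
apply: (@integrable_le _ h _ (fun z => `|psi c| * `|u z|)).
- apply: measurable_funM; first exact: integrable_measurable.
  by apply: measurable_funTS; exact: continuous_measurable_fun.
- move=> z Dz; rewrite normrM mulrC ler_wpM2r// cmax//.
  exact: subset_itv_oo_cc.
- apply: (@integrableZl _ _ _ mu D mD `|psi c| (fun z => `|u z|%:E)).
  exact: integrable_norm.
Qed.

Lemma weak_deriv_cst (c : R) : is_weak_deriv h (cst c) (cst 0).
Proof.
move=> phi tphi; rewrite /= (_ : (fun z => 0 * phi z) = cst 0); last first.
  by apply/funext => z; rewrite mul0r.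
have [dphi [a [b [a0 bh phi0]]]] := tphi.
(* Both boundary values vanish since the support lies strictly inside ]0, h[; the identity is then
   the fundamental theorem of calculus for c phi. *)
rewrite [RHS](_ : _ = c * phi h - c * phi 0); last first.
  rewrite /int0 Rintegral_cst// mul0r oppr0 !phi0 ?mulr0 ?subrr//.
  - by rewrite leNgt a0.
  - by rewrite negb_and -!ltNge bh orbT.
apply: (int0_FTC _ (fun z => c * phi z)).
- move=> z; apply: cvgM; first exact: cvg_cst.
  exact: (@test_function_continuous _ 1%N).
- move=> z; have dz : derivable phi z 1 by exact: (dphi 0%N).
  have /derivableP dz' := dz.
  rewrite (_ : (fun y => c * phi y) = cst c * phi)//.
  by apply: trigger_derive; rewrite /GRing.scale/= mulr0 addr0 derive1E.
Qed.

Lemma L2_bounded (u : R -> R) (C : R) : measurable_fun D u ->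
  (forall z, D z -> `|u z| <= C) -> L2 h u.
Proof.
move=> mu_ uC; split => //; apply: (integrable_bounded h _ (C ^+ 2)).
  exact: measurable_funX.
by move=> z Dz; rewrite normrX ler_sqr ?nnegrE ?uC// (le_trans _ (uC z Dz)).
Qed.

Lemma L2_cst (c : R) : L2 h (cst c).
Proof. exact: (L2_bounded _ `|c|). Qed.

Lemma W12_cst (c : R) : W12 h (cst c).
Proof.
split; first exact: L2_cst.
by exists (cst 0); split; [exact: L2_cst|exact: weak_deriv_cst].
Qed.

Lemma L2Z (c : R) (u : R -> R) : L2 h u -> L2 h (fun z => c * u z).
Proof.
move=> [mu_ iu]; split; first exact: measurable_funM.
rewrite (_ : (fun z => _) = fun z => (c ^+ 2)%:E * (u z ^+ 2)%:E)%E.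
  exact: integrableZl.
by apply/funext => z; rewrite exprMn.
Qed.

Lemma is_weak_derivZ (c : R) (u g : R -> R) : L2 h u -> L2 h g ->
  is_weak_deriv h u g ->
  is_weak_deriv h (fun z => c * u z) (fun z => c * g z).
Proof.
move=> /L2_integrable iu /L2_integrable ig ug phi tphi.
have eZ v psi : mu.-integrable D (EFin \o (fun z => v z * psi z)) ->
    int0 h (fun z => c * v z * psi z) = c * int0 h (fun z => v z * psi z).
  move=> iv; rewrite /int0 -RintegralZl//.
  by apply: eq_Rintegral => z _; rewrite mulrA.
rewrite eZ; last exact: (integrable_test _ _ 1%N).
by rewrite eZ ?ug ?mulrN//; exact: (integrable_test _ _ 0%N).
Qed.

(** Both candidates have the same integral against every bump, so [ae_null_bump] applies to their
    difference. *)
Lemma weak_deriv_unique (u g1 g2 : R -> R) : L2 h g1 -> L2 h g2 ->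
  is_weak_deriv h u g1 -> is_weak_deriv h u g2 ->
  ae_null h (fun z => g1 z - g2 z).
Proof.
move=> /L2_integrable i1 /L2_integrable i2 ug1 ug2.
apply: ae_null_bump => [|n b /(@test_function_bump _ h n) tb].
  exact: (@integrableB _ _ _ mu D mD (fun z => (g1 z)%:E) (fun z => (g2 z)%:E)).
have /eqP := ug1 _ tb; rewrite ug2// eqr_opp => /eqP g21.
rewrite /int0; under eq_Rintegral do rewrite mulrBl.
rewrite RintegralB//; last 2 first.
- exact: (integrable_test _ _ 0%N).
- exact: (integrable_test _ _ 0%N).
by move: g21; rewrite /int0 => ->; rewrite subrr.
Qed.

Lemma weak_derivP (u : R -> R) : W12 h u ->
  L2 h (weak_deriv h u) /\ is_weak_deriv h u (weak_deriv h u).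
Proof.
move=> [_ [g ?]].
by apply: (@xgetPex _ (cst 0) [set g | _ g /\ _ g]); exists g.
Qed.

End weak_derivatives.

(** * The energy along a line through the origin *)

Section twist_potential.
Context {R : realType}.
Variables (B a : R).
Implicit Types (c s : R).

(** The potential W(z, s), with [c] the value c(z), [B] standing for k1 sigma^2 and [a] for cos^2
    theta0. The next two definitions are its derivatives in [s]. *)
Definition twist c s : R := - (B * cos s ^+ 2) + c * (a - sin s ^+ 2) ^+ 2.

Definition twist1 c s : R :=
  (B - 2 * c * (a - sin s ^+ 2)) * (2 * (sin s * cos s)).

Definition twist2 c s : R :=
  8 * c * (sin s * cos s) ^+ 2 +
  (B - 2 * c * (a - sin s ^+ 2)) * (2 * (cos s ^+ 2 - sin s ^+ 2)).

Lemma is_derive_twist c s : is_derive s 1 (twist c) (twist1 c s).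
Proof.
rewrite (_ : twist c = - (cst B * cos ^+ 2) + cst c * (cst a - sin ^+ 2) ^+ 2)//.
by apply: trigger_derive; rewrite /GRing.scale/= /twist1 !fctE/=; ring.
Qed.

Lemma is_derive_twist1 c s : is_derive s 1 (twist1 c) (twist2 c s).
Proof.
rewrite (_ : twist1 c = (cst B - cst (2 * c) * (cst a - sin ^+ 2)) *
  (cst 2 * (sin * cos)))//.
by apply: trigger_derive; rewrite /GRing.scale/= /twist2 !fctE/=; ring.
Qed.

Lemma twist2_0 c : twist2 c 0 = 2 * (B - 2 * c * a).
Proof. by rewrite /twist2 sin0 cos0; ring. Qed.

Hypotheses (B_ge0 : 0 <= B) (a01 : 0 <= a <= 1).

Let normr_sub_sin2 s : `|a - sin s ^+ 2| <= 1.
Proof.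
have := sin2cos2 s; have := sqr_ge0 (cos s).
have := sqr_ge0 (sin s); case/andP: a01 => a0 a1 s0 c0' sc.
by rewrite ler_norml; apply/andP; split; lra.
Qed.

Let factor_le c C s : 0 <= c <= C ->
  `|B - 2 * c * (a - sin s ^+ 2)| <= B + 2 * C.
Proof.
move=> /andP[c0 cC]; rewrite (le_trans (ler_normB _ _))// ger0_norm// lerD2l.
rewrite normrM ger0_norm ?mulr_ge0// -mulrA ler_pM2l//.
by rewrite (le_trans _ cC)// ler_piMr.
Qed.

Let sin_cos_le s : `|sin s * cos s| <= 1.
Proof.
have := sin2cos2 s; have := sqr_ge0 (sin s - cos s).
have := sqr_ge0 (sin s + cos s) => s0 c0 sc.
by rewrite ler_norml; apply/andP; split; nra.
Qed.

(** This bound and the next two are uniform in [s] and in [c]; they give the integrability and the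
    domination used along lines. *)
Lemma normr_twist_le c C s : 0 <= c <= C -> `|twist c s| <= B + C.
Proof.
move=> /andP[c0 cC]; rewrite (le_trans (ler_normD _ _))// normrN lerD//.
  by rewrite normrM ger0_norm// ler_piMr// normrX exprn_ile1// cos_max.
rewrite normrM (ger0_norm c0) (le_trans _ cC)// ler_piMr//.
by rewrite normrX exprn_ile1.
Qed.

Lemma normr_twist1_le c C s : 0 <= c <= C -> `|twist1 c s| <= (B + 2 * C) * 2.
Proof.
move=> cC; rewrite /twist1 normrM ler_pM// ?factor_le//.
by rewrite normrM ger0_norm// ler_piMr.
Qed.

Lemma normr_twist2_le c C s : 0 <= c <= C ->
  `|twist2 c s| <= 8 * C + (B + 2 * C) * 2.
Proof.
move=> /[dup] cC /andP[c0 cC']; rewrite (le_trans (ler_normD _ _))// lerD//.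
  rewrite normrM ger0_norm ?mulr_ge0// -mulrA ler_pM2l//.
  by rewrite (le_trans _ cC')// ler_piMr// normrX exprn_ile1.
rewrite normrM ler_pM// ?factor_le//.
have := sin2cos2 s; have := sqr_ge0 (cos s).
have := sqr_ge0 (sin s) => s0 c0' sc.
by rewrite ler_norml; apply/andP; split; lra.
Qed.

End twist_potential.

(** * Differentiation under the integral sign on ]0, h[ *)

Section energy_along_lines.
Context {R : realType}.
Notation mu := (@lebesgue_measure R).
Variable h : R.
Let D : set R := `]0, h[.
Let mD : measurable D := measurable_itv _.

(** Domination is asked only within distance 1 of [e], because the derivative 2 k x g^2 of the
    gradient term is unbounded in x. *)
Lemma is_derive_int0 (f f1 : R -> R -> R) (G : R -> R) (e : R) :
  (forall x, mu.-integrable D (EFin \o f x)) ->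
  (forall x z : R, is_derive x 1 (f ^~ z) (f1 x z)) ->
  (forall z, 0 <= G z) -> mu.-integrable D (EFin \o G) ->
  (forall x z, e - 1 < x < e + 1 -> D z -> `|f1 x z| <= G z) ->
  is_derive e 1 (fun x => int0 h (f x)) (int0 h (f1 e)).
Proof.
move=> intf df G0 iG f1G.
have d1E : partial1of2 f = f1.
  by apply/funext => x; apply/funext => z; rewrite partial1of2E; exact: derive_val.
have Ie : [set` `]e - 1, e + 1[%R] e by rewrite /= in_itv/= ltrBlDr ltrDl ltr01.
have if' x : [set` `]e - 1, e + 1[%R] x -> mu.-integrable D (EFin \o f x).
  by move=> _; exact: intf.
have df' x z : [set` `]e - 1, e + 1[%R] x -> D z -> derivable (f^~ z) x 1.
  by move=> _ _; exact: ex_derive.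
have ub x z : [set` `]e - 1, e + 1[%R] x -> D z ->
    `|partial1of2 f x z| <= G z.
  by rewrite /= in_itv/= d1E => ? ?; exact: f1G.
apply: DeriveDef.
  exact: (derivable_under_integral (mu := mu) mD Ie if' df' G0 iG ub).
rewrite -derive1E.
rewrite (differentiation_under_integral (mu := mu) mD Ie if' df' G0 iG ub)//.
by rewrite d1E.
Qed.

End energy_along_lines.

(** * First and second derivatives of the energy along a line *)

Section energy_variations.
Context {R : realType}.
Notation mu := (@lebesgue_measure R).
Variables (h k B a C : R) (b c eta g : R -> R).
Let D : set R := `]0, h[.
Let mD : measurable D := measurable_itv _.
Hypotheses (k_ge0 : 0 <= k) (B_ge0 : 0 <= B) (a01 : 0 <= a <= 1).
Hypotheses (c_bnd : forall z, 0 <= c z <= C) (mc : measurable_fun D c).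
Hypotheses (L2eta : L2 h eta) (L2g : L2 h g).
Hypotheses (ib : mu.-integrable D (EFin \o b)).

Definition line_density (x z : R) : R :=
  k * (x * g z) ^+ 2 + twist B a (c z) (x * eta z) + b z.

Definition line_density1 (x z : R) : R :=
  2 * k * x * g z ^+ 2 + twist1 B a (c z) (x * eta z) * eta z.

Definition line_density2 (x z : R) : R :=
  2 * k * g z ^+ 2 + twist2 B a (c z) (x * eta z) * eta z ^+ 2.

Let iD (u v : R -> R) : mu.-integrable D (EFin \o u) ->
  mu.-integrable D (EFin \o v) ->
  mu.-integrable D (EFin \o (fun z => u z + v z)).
Proof.
move=> iu iv; exact: (@integrableD _ _ _ mu D mD (EFin \o u) (EFin \o v)).
Qed.

Let iZ r (u : R -> R) : mu.-integrable D (EFin \o u) ->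
  mu.-integrable D (EFin \o (fun z => r * u z)).
Proof. move=> iu; exact: (@integrableZl _ _ _ mu D mD r (EFin \o u)). Qed.

Let ieta := L2_integrable _ _ L2eta.
Let meta : measurable_fun D eta := L2eta.1.
Let mg : measurable_fun D g := L2g.1.
Let ig2 : mu.-integrable D (EFin \o (fun z => g z ^+ 2)) := L2g.2.
Let ieta2 : mu.-integrable D (EFin \o (fun z => eta z ^+ 2)) := L2eta.2.

Let mcont (w : R -> R) (x : R) : continuous w ->
  measurable_fun D (fun z => w (x * eta z)).
Proof.
move=> cw; apply: measurableT_comp; first exact: continuous_measurable_fun.
exact: measurable_funM.
Qed.

Let msin x := mcont (@sin R) x (@continuous_sin R).
Let mcos x := mcont (@cos R) x (@continuous_cos R).

Let mfac x : measurable_fun D (fun z => a - sin (x * eta z) ^+ 2).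
Proof. by apply: measurable_funB => //; exact: measurable_funX. Qed.

Let mfac1 x :
  measurable_fun D (fun z => B - 2 * c z * (a - sin (x * eta z) ^+ 2)).
Proof.
apply: measurable_funB => //; apply: measurable_funM => //.
exact: measurable_funM.
Qed.

Let mtwist x : measurable_fun D (fun z => twist B a (c z) (x * eta z)).
Proof.
apply: measurable_funD.
  apply: measurableT_comp => //; apply: measurable_funM => //.
  exact: measurable_funX.
by apply: measurable_funM => //; exact: measurable_funX.
Qed.

Let mtwist1 x : measurable_fun D (fun z => twist1 B a (c z) (x * eta z)).
Proof.
apply: measurable_funM => //.
by apply: measurable_funM => //; exact: measurable_funM.
Qed.

Let mtwist2 x : measurable_fun D (fun z => twist2 B a (c z) (x * eta z)).
Proof.
apply: measurable_funD; apply: measurable_funM => //.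
- exact: measurable_funM.
- by apply: measurable_funX; exact: measurable_funM.
- apply: measurable_funM => //.
  by apply: measurable_funB; exact: measurable_funX.
Qed.

Lemma integrable_line_density x : mu.-integrable D (EFin \o line_density x).
Proof.
apply: iD => //; apply: iD.
  rewrite (_ : (fun z => _) = fun z => (k * x ^+ 2) * g z ^+ 2); first exact: iZ.
  by apply/funext => z; rewrite exprMn mulrA.
apply: (integrable_bounded h _ (B + C)) => // z _.
exact: normr_twist_le.
Qed.

Lemma integrable_line_density1 x : mu.-integrable D (EFin \o line_density1 x).
Proof.
apply: iD; first exact: iZ.
apply: (integrable_le h _ (fun z => (B + 2 * C) * 2 * `|eta z|)).
- exact: measurable_funM.
- by move=> z _; rewrite normrM ler_wpM2r// normr_twist1_le.
- by apply: iZ; apply: integrable_norm; exact: ieta.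
Qed.

Lemma integrable_line_density2 x : mu.-integrable D (EFin \o line_density2 x).
Proof.
apply: iD; first exact: iZ.
apply: (integrable_le h _ (fun z => (8 * C + (B + 2 * C) * 2) * eta z ^+ 2)).
- by apply: measurable_funM => //; exact: measurable_funX.
- move=> z _; rewrite normrM (ger0_norm (sqr_ge0 _)).
  by rewrite ler_wpM2r ?sqr_ge0// normr_twist2_le.
- exact: iZ.
Qed.

Let is_derive_mulr_cst (y x : R) : is_derive x 1 (fun x => x * y) y.
Proof.
rewrite (_ : (fun x => x * y) = id * cst y)//.
by apply: trigger_derive; rewrite /GRing.scale/=; ring.
Qed.

Let C_ge0 : 0 <= C.
Proof. by have /andP[c0 cC] := c_bnd 0; exact: le_trans cC. Qed.

Let M_ge0 : 0 <= (B + 2 * C) * 2.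
Proof. by rewrite mulr_ge0// addr_ge0// mulr_ge0. Qed.

Lemma is_derive_line_energy (x : R) :
  is_derive x 1 (fun x => int0 h (line_density x)) (int0 h (line_density1 x)).
Proof.
(* The factor [|x| + 1] bounds the parameter on the unit window around [x]; the other constant is
   the bound on [twist1]. *)
apply: (is_derive_int0 _ _ _
  (fun z => 2 * k * (`|x| + 1) * g z ^+ 2 + (B + 2 * C) * 2 * `|eta z|)).
- exact: integrable_line_density.
- move=> y z.
  have dg := is_derive_mulr_cst (g z) y.
  have dt := @is_derive1_comp _ _ (fun y => y * eta z) _ _ _
    (is_derive_twist B a (c z) (y * eta z))
    (is_derive_mulr_cst (eta z) y).
  rewrite (_ : line_density ^~ z = cst k * (fun y => y * g z) ^+ 2 +
    (twist B a (c z) \o (fun y => y * eta z)) + cst (b z))//.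
  apply: trigger_derive; rewrite /GRing.scale/= /line_density1; ring.
- move=> z; apply: addr_ge0; apply: mulr_ge0; rewrite ?sqr_ge0//.
  by apply: mulr_ge0; [exact: mulr_ge0|exact: addr_ge0].
- apply: iD; first exact: iZ.
  by apply: iZ; apply: integrable_norm; exact: ieta.
- move=> y z xy Dz; rewrite (le_trans (ler_normD _ _))// lerD//.
    rewrite normrM (ger0_norm (sqr_ge0 _)) ler_wpM2r ?sqr_ge0//.
    rewrite normrM ger0_norm ?mulr_ge0// ler_wpM2l ?mulr_ge0//.
    have := ler_norm x; have := ler_norm (- x); rewrite normrN => x1 x2.
    by rewrite ler_norml; apply/andP; split; lra.
  by rewrite normrM ler_wpM2r// normr_twist1_le.
Qed.

Lemma is_derive_line_energy1 (x : R) :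
  is_derive x 1 (fun x => int0 h (line_density1 x)) (int0 h (line_density2 x)).
Proof.
(* The chain rule produces a second factor [eta], so [eta z ^+ 2] is multiplied by the bound on
   [twist2]; the gradient term no longer depends on the parameter. *)
apply: (is_derive_int0 _ _ _
  (fun z => 2 * k * g z ^+ 2 + (8 * C + (B + 2 * C) * 2) * eta z ^+ 2)).
- exact: integrable_line_density1.
- move=> y z.
  have dt := @is_derive1_comp _ _ (fun y => y * eta z) _ _ _
    (is_derive_twist1 B a (c z) (y * eta z))
    (is_derive_mulr_cst (eta z) y).
  rewrite (_ : line_density1 ^~ z = cst (2 * k) * id * cst (g z ^+ 2) +
    (twist1 B a (c z) \o (fun y => y * eta z)) * cst (eta z))//.
  by apply: trigger_derive; rewrite /GRing.scale/= /line_density2; ring.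
- move=> z; apply: addr_ge0; apply: mulr_ge0; rewrite ?sqr_ge0 ?mulr_ge0//.
  by apply: addr_ge0 => //; exact: mulr_ge0.
- by apply: iD; exact: iZ.
- move=> y z xy Dz; rewrite (le_trans (ler_normD _ _))// lerD//.
    by rewrite ger0_norm//; apply: mulr_ge0; [exact: mulr_ge0|exact: sqr_ge0].
  rewrite normrM (ger0_norm (sqr_ge0 _)).
  by rewrite ler_wpM2r ?sqr_ge0// normr_twist2_le.
Qed.

(** The integrand itself is zero: each term carries a factor x or sin (x eta). *)
Lemma line_density1_0 : int0 h (line_density1 0) = 0.
Proof.
rewrite /int0 (_ : line_density1 0 = cst 0) ?Rintegral_cst ?mul0r//.
by apply/funext => z; rewrite /line_density1 /twist1 mul0r sin0 /=; ring.
Qed.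

Lemma line_density2_0 z : line_density2 0 z =
  2 * (k * g z ^+ 2 + (B - 2 * c z * a) * eta z ^+ 2).
Proof. by rewrite /line_density2 mul0r twist2_0; ring. Qed.

End energy_variations.

(** * The energy of a sinusoidal density modulation *)

Section modulated_energy.
Context {R : realType}.
Notation mu := (@lebesgue_measure R).
Variables (k1 sigma d f lambda1 lambda2 theta0 q h t : R).
Hypothesis h_gt0 : 0 < h.
Let D : set R := `]0, h[.
Let mD : measurable D := measurable_itv _.

Let B := k1 * sigma ^+ 2.
Let a := cos theta0 ^+ 2.
Let rho (z : R) := t * sin (q * z).
Let C := lambda2 * q ^+ 4 * t ^+ 2.
Let b (z : R) := d / 2 * rho z ^+ 2 + f / 4 * rho z ^+ 4.
Let c (z : R) := C * sin (q * z) ^+ 2.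

Hypotheses (k1_gt0 : 0 < k1) (lambda2_gt0 : 0 < lambda2).

Let is_derive_scale (y z : R) : is_derive z 1 (fun z => y * z) y.
Proof.
rewrite (_ : (fun z => y * z) = cst y * id)//.
by apply: trigger_derive; rewrite /GRing.scale/=; ring.
Qed.

Let int0_cst (x : R) : int0 h (cst x) = x * h.
Proof.
rewrite (_ : x * h = x * h - x * 0); last by rewrite mulr0 subr0.
apply: (int0_FTC _ h_gt0 _ (fun z => x * z)) => z; first exact: cvg_cst.
exact: is_derive_scale.
Qed.

(** Hence the [lambda1] term of the energy vanishes, and the [lambda2] term becomes lambda2 q^4
    rho^2 (cos^2 theta0 - sin^2 theta)^2. *)
Lemma derive2_modulation z : (rho^`(2))%classic z = - q ^+ 2 * rho z.
Proof.
have d1 : (rho^`())%classic = fun z => t * q * cos (q * z).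
  apply/funext => {}z; rewrite derive1E; apply: derive_val.
  have ds := @is_derive1_comp _ _ (fun z => q * z) _ _ _
    (is_derive_sin (q * z)) (is_derive_scale q z).
  rewrite (_ : rho = cst t * (sin \o (fun z => q * z)))//.
  by apply: trigger_derive; rewrite /GRing.scale/=; ring.
rewrite derive1nS derive1n1 d1 derive1E; apply: derive_val.
have ds := @is_derive1_comp _ _ (fun z => q * z) _ _ _
  (is_derive_cos (q * z)) (is_derive_scale q z).
rewrite (_ : (fun z => _) = cst (t * q) * (cos \o (fun z => q * z)))//.
by apply: trigger_derive; rewrite /GRing.scale/= /rho; ring.
Qed.

Let continuous_sinq : continuous (fun z : R => sin (q * z)).
Proof.
move=> z; apply: (continuous_comp _ (@continuous_sin R _)).
by apply: cvgM; [exact: cvg_cst|exact: cvg_id].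
Qed.

Let msinq : measurable_fun D (fun z => sin (q * z)).
Proof. by apply: measurable_funTS; exact: continuous_measurable_fun. Qed.

Let mc : measurable_fun D c.
Proof. by apply: measurable_funM => //; exact: measurable_funX. Qed.

Let C_ge0 : 0 <= C.
Proof.
apply: mulr_ge0; last exact: sqr_ge0.
by apply: mulr_ge0; [exact: ltW|exact: exprn_even_ge0].
Qed.

Let c_bnd z : 0 <= c z <= C.
Proof.
apply/andP; split; first by apply: mulr_ge0 => //; exact: sqr_ge0.
by rewrite ler_piMr// -real_normK ?num_real// exprn_ile1 ?sin_max.
Qed.

Let ib : mu.-integrable D (EFin \o b).
Proof.
suff : mu.-integrable `[0, h] (EFin \o b).
  by apply: integrableS => //; exact: subset_itv_oo_cc.
apply: continuous_compact_integrable; first exact: segment_compact.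
apply: continuous_subspaceT => z.
have cr : {for z, continuous rho}.
  by apply: cvgM; [exact: cvg_cst|exact: continuous_sinq].
by apply: cvgD; apply: cvgM; (try exact: cvg_cst);
  exact: (continuous_comp cr (@exprn_continuous _ _ _)).
Qed.

Let a01 : 0 <= a <= 1.
Proof.
by rewrite /a sqr_ge0/= -real_normK ?num_real// exprn_ile1 ?cos_max.
Qed.

Let B_ge0 : 0 <= B.
Proof. by rewrite mulr_ge0 ?sqr_ge0// ltW. Qed.

Let k1_ge0 : 0 <= k1 := ltW k1_gt0.

Lemma eq_int0_ae (u v : R -> R) : mu.-integrable D (EFin \o u) ->
  mu.-integrable D (EFin \o v) ->
  {ae mu, forall z, 0 < z < h -> u z = v z} -> int0 h u = int0 h v.
Proof.
move=> /measurable_int mu_ /measurable_int mv uv; rewrite /int0 /Rintegral.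
congr fine; apply: ae_eq_integral => //.
apply: filterS uv; first exact: (ae_filter_ringOfSetsType mu).
by move=> z uvz Dz; rewrite uvz//; move: Dz; rewrite /= in_itv.
Qed.

Local Notation F := (fun theta =>
  energy k1 sigma d f lambda1 lambda2 theta0 q h theta rho).

(** The weak derivative chosen in the energy agrees almost everywhere with x g, by uniqueness, so
    the integral does not see the choice. *)
Lemma energy_line (eta g : R -> R) (x : R) :
  L2 h eta -> L2 h g -> is_weak_deriv h eta g ->
  F (fun z => x * eta z) = int0 h (line_density k1 B a b c eta g x).
Proof.
move=> Leta Lg etag.
have Lxeta := L2Z h x eta Leta; have Lxg := L2Z h x g Lg.
have xetag := is_weak_derivZ h h_gt0 x eta g Leta Lg etag.
have Wxeta : W12 h (fun z => x * eta z).
  by split => //; exists (fun z => x * g z).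
have [Lw xetaw] := weak_derivP _ _ Wxeta.
have wg := weak_deriv_unique h h_gt0 _ _ _ Lw Lxg xetaw xetag.
(* Taking x eta as the direction and 1 as the parameter makes both integrands instances of
   [line_density], so one integrability lemma covers both. *)
transitivity (int0 h
    (line_density k1 B a b c (fun z => x * eta z)
      (weak_deriv h (fun z => x * eta z)) 1)).
  apply: eq_Rintegral => z _; rewrite derive2_modulation.
  by rewrite /line_density /twist /b /c /C /rho /a /B !mul1r; ring.
apply: eq_int0_ae.
- exact: (integrable_line_density _ _ _ _ C).
- exact: (integrable_line_density _ _ _ _ C).
apply: filterS wg; first exact: (ae_filter_ringOfSetsType mu).
move=> z + /[dup] zh => /[apply] /eqP; rewrite subr_eq0 => /eqP wgz.
by rewrite /line_density !mul1r wgz.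
Qed.

Lemma critical_point0 : critical_point h F (cst 0).
Proof.
split.
  split; first exact: W12_cst.
  by apply: aeW => z _; rewrite /= oppr_le0 andbb divr_ge0 ?pi_ge0.
move=> eta Weta; have [Lg etag] := weak_derivP _ _ Weta.
have [Leta _] := Weta.
rewrite (_ : (fun eps => _) =
    fun x => int0 h (line_density k1 B a b c eta (weak_deriv h eta) x)); last first.
  apply/funext => x; rewrite -energy_line//; congr (energy _ _ _ _ _ _ _ _ _ _).
  by apply/funext => z; rewrite add0r.
apply: trigger_derive;
  last exact: (line_density1_0 h k1 B a c eta (weak_deriv h eta)).
exact: (is_derive_line_energy _ _ _ _ C).
Qed.

(** Any square-integrable weak derivative [g] is allowed, so that constants can be handled with [g]
    equal to 0. *)
Lemma second_variationE (eta g : R -> R) :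
  L2 h eta -> L2 h g -> is_weak_deriv h eta g ->
  second_variation F eta =
    int0 h (fun z => 2 * (k1 * g z ^+ 2 + (B - 2 * c z * a) * eta z ^+ 2)).
Proof.
move=> Leta Lg etag; rewrite /second_variation.
rewrite (_ : (fun eps => _) =
    fun x => int0 h (line_density k1 B a b c eta g x)); last first.
  by apply/funext => x; exact: energy_line.
have dE : ((fun x => int0 h (line_density k1 B a b c eta g x))^`())%classic =
    fun x => int0 h (line_density1 k1 B a c eta g x).
  apply/funext => x; rewrite derive1E; apply: derive_val.
  exact: (is_derive_line_energy _ _ _ _ C).
rewrite derive1nS derive1n1 dE derive1E.
rewrite (_ : (fun z => _ * _) = line_density2 k1 B a c eta g 0).
  by apply: derive_val; exact: (is_derive_line_energy1 _ _ _ _ C).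
by apply/funext => z; rewrite line_density2_0.
Qed.

(** A nonnegative function with zero integral vanishes almost everywhere. This makes the
    denominators of the Rayleigh quotients positive. *)
Lemma int0_sqr_gt0 (u : R -> R) :
  L2 h u -> ~ ae_null h u -> 0 < int0 h (fun z => u z ^+ 2).
Proof.
move=> [mu_ iu2] u0; rewrite lt_def; apply/andP; split; last first.
  by apply: Rintegral_ge0 => z _; exact: sqr_ge0.
apply/eqP; rewrite /int0 /Rintegral => iu0; apply: u0.
have fI : (\int[mu]_(z in D) (u z ^+ 2)%:E \is a fin_num)%E.
  exact: integrable_fin_num.
have mu2 : measurable_fun D (fun z => (u z ^+ 2)%:E).
  by apply/measurable_EFinP; exact: measurable_funX.
have [+ _] := @ae_eq_integral_abs _ _ _ mu D mD _ mu2.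
under eq_integral do rewrite gee0_abs ?lee_fin ?sqr_ge0//.
rewrite -(fineK fI) iu0 => /(_ erefl) ae0.
apply: (@filterS _ _ (ae_filter_ringOfSetsType mu) _ _ _ ae0).
move=> z /= uz zh; apply/eqP; rewrite -sqrf_eq0; apply/eqP.
by have [] : (u z ^+ 2)%:E = 0%E by apply: uz; rewrite /D/= in_itv/=.
Qed.

(** Dropping the gradient term and using c <= C bounds every Rayleigh quotient below by 2 (B - 2 C
    a), a positive constant independent of the variation; hence the infimum itself is positive. *)
Lemma zero_stable_modulation : 0 < B - 2 * C * a -> zero_stable h F.
Proof.
move=> BC; rewrite /zero_stable /rayleigh_inf.
apply: (@lt_le_trans _ _ (2 * (B - 2 * C * a))%:E).
  by rewrite lte_fin mulr_gt0.
apply: le_ereal_inf_tmp => _ [eta [Weta eta0] <-].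
have [Lg etag] := weak_derivP _ _ Weta; have [Leta _] := Weta.
rewrite lee_fin (second_variationE eta (weak_deriv h eta))//.
have eta_gt0 := int0_sqr_gt0 eta Leta eta0.
rewrite ler_pdivlMr// /int0 -RintegralZl//; last exact: Leta.2.
apply: le_Rintegral => //.
- apply: (@integrableZl _ _ _ mu D mD _ (fun z => (eta z ^+ 2)%:E)).
  exact: Leta.2.
- rewrite (_ : EFin \o _ =
      EFin \o line_density2 k1 B a c eta (weak_deriv h eta) 0); last first.
    by apply/funext => z; rewrite /= line_density2_0.
  exact: (integrable_line_density2 _ _ _ _ C).
move=> z _; rewrite -mulrA ler_pM2l//.
apply: ler_wpDl; first by apply: mulr_ge0 => //; exact: sqr_ge0.
apply: ler_wpM2r; first exact: sqr_ge0.
have /andP[_ cC] := c_bnd z; have /andP[a0 _] := a01.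
by rewrite lerD2l lerN2 ler_wpM2r// ler_pM2l.
Qed.

Hypotheses (q_neq0 : q != 0) (sinqh : sin (q * h) = 0).

Lemma int0_affine_sin2 (x y : R) :
  int0 h (fun z => x + y * sin (q * z) ^+ 2) = (x + y / 2) * h.
Proof.
(* A primitive of the integrand; its oscillating part vanishes at both ends since sin (q h) = 0. *)
pose U (z : R) := x * z + y * (z / 2 - sin (q * z) * cos (q * z) / (2 * q)).
rewrite (_ : _ * h = U h - U 0); last first.
  by rewrite /U sinqh !mulr0 sin0 !mul0r; field.
apply: int0_FTC => // z.
- apply: cvgD; first exact: cvg_cst.
  apply: cvgM; first exact: cvg_cst.
  exact: (continuous_comp (continuous_sinq z) (@exprn_continuous _ _ _)).
- have ds := @is_derive1_comp _ _ (fun z => q * z) _ _ _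
    (is_derive_sin (q * z)) (is_derive_scale q z).
  have dc := @is_derive1_comp _ _ (fun z => q * z) _ _ _
    (is_derive_cos (q * z)) (is_derive_scale q z).
  rewrite (_ : U = cst x * id + cst y * (id * cst 2^-1 -
    (sin \o (fun z => q * z)) * (cos \o (fun z => q * z)) * cst (2 * q)^-1))//.
  apply: trigger_derive; rewrite /GRing.scale/=.
  transitivity (x + y * (2^-1 - (cos (q * z) ^+ 2 - sin (q * z) ^+ 2) / 2)).
    by field.
  by rewrite cos2sin2; field.
Qed.

(** The quotient of the variation 1 equals 2 (B - C a): there is no gradient term and sin^2 (q z)
    averages to 1/2. *)
Lemma zero_unstable_modulation : B - C * a < 0 -> zero_unstable h F.
Proof.
move=> BC; rewrite /zero_unstable /rayleigh_inf.
apply: (@le_lt_trans _ _ (second_variation F (cst 1) /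
    int0 h (fun z => (cst 1 : R -> R) z ^+ 2))%:E).
  apply: ereal_inf_lbound; exists (cst 1) => //; split; first exact: W12_cst.
  (* If 1 were null almost everywhere, its integral h would be 0. *)
  move=> null1; have := @eq_int0_ae (cst 1) (cst 0) _ _ null1.
  rewrite !int0_cst mul0r mul1r => h0.
  have : h = 0 by apply: h0; exact: (L2_integrable _ _ (L2_cst _ _)).
  by apply/eqP; rewrite gt_eqF.
rewrite lte_fin (second_variationE (cst 1) (cst 0))//; last 3 first.
- exact: L2_cst.
- exact: L2_cst.
- exact: weak_deriv_cst.
rewrite (_ : (fun z => _) = fun z => 2 * B + (- 4 * C * a) * sin (q * z) ^+ 2);
  last by apply/funext => z; rewrite /c /cst; ring.
rewrite int0_affine_sin2 (_ : (fun z => _) = cst 1); last first.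
  by apply/funext => z; rewrite /= expr1n.
rewrite int0_cst mul1r mulfK ?gt_eqF//.
by rewrite (_ : _ + _ = 2 * (B - C * a)) ?pmulr_rlt0//; field.
Qed.

Lemma energy_cst (s : R) :
  F (cst s) = (C / 2 * (a - sin s ^+ 2) ^+ 2 - B * cos s ^+ 2) * h + int0 h b.
Proof.
(* The constant is the point of parameter 1 on the line it spans, with weak derivative 0. *)
rewrite (_ : cst s = fun z => 1 * cst s z); last first.
  by apply/funext => z; rewrite mul1r.
rewrite (energy_line _ (cst 0)); last 3 first.
- exact: L2_cst.
- exact: L2_cst.
- exact: weak_deriv_cst.
rewrite -[LHS](subrK (int0 h b)) -[X in X + _ = _]RintegralB//; last first.
  apply: (integrable_line_density _ _ _ _ C) => //; exact: L2_cst.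
congr (_ + _).
transitivity (int0 h (fun z =>
  - (B * cos s ^+ 2) + C * (a - sin s ^+ 2) ^+ 2 * sin (q * z) ^+ 2)).
  congr (int0 h _); apply/funext => z.
  by rewrite /line_density /twist /c /cst !mul1r; ring.
by rewrite int0_affine_sin2; field.
Qed.

End modulated_energy.

(** * Minimization over constants *)

Section quadratic_minimum.
Context {R : realFieldType}.
Variables (A L a : R).
Hypotheses (A_ge0 : 0 <= A) (L_gt0 : 0 < L) (a_ge0 : 0 <= a).

(** The minimizer on [0, +oo[ of A (a - x)^2 + L x: the vertex of the parabola projected onto the
    half-line. For A = 0 the function is increasing and the minimizer is 0. *)
Definition clipped_vertex : R :=
  if A == 0 then 0 else Num.max (a - L / (2 * A)) 0.

Lemma clipped_vertex_ge0 : 0 <= clipped_vertex.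
Proof.
by rewrite /clipped_vertex; case: ifPn => // _; rewrite le_max lexx orbT.
Qed.

Lemma clipped_vertex_le : clipped_vertex <= a.
Proof.
rewrite /clipped_vertex; case: ifPn => // A0.
by rewrite ge_max a_ge0 andbT gerBl; apply: divr_ge0; [exact: ltW|exact: mulr_ge0].
Qed.

(** Strictness gives uniqueness of the minimizer, needed to describe the whole set of minimizing
    constants. *)
Lemma quadratic_lt (x : R) : 0 <= x -> x != clipped_vertex ->
  A * (a - clipped_vertex) ^+ 2 + L * clipped_vertex < A * (a - x) ^+ 2 + L * x.
Proof.
rewrite /clipped_vertex => x0; have [->|A0 xx] := eqVneq A 0.
  by move=> xn0; rewrite !mul0r mulr0 !add0r pmulr_rgt0// lt_def xn0.
have A_gt0 : 0 < A by rewrite lt_def A0.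
rewrite -subr_gt0; move: xx; case: (leP (a - L / (2 * A)) 0) => v0 xx.
(* A vertex at or below 0 means 2 A a <= L, so the linear part of the increment from 0 is
   nonnegative. *)
- have x_gt0 : 0 < x by rewrite lt_def xx.
  have aL : 2 * A * a <= L.
    by move: v0; rewrite subr_le0 ler_pdivlMr ?mulr_gt0// mulrC.
  have -> : A * (a - x) ^+ 2 + L * x - (A * (a - 0) ^+ 2 + L * 0) =
      A * x ^+ 2 + (L - 2 * A * a) * x by ring.
  by rewrite ltr_wpDr ?mulr_gt0 ?exprn_gt0// mulr_ge0// subr_ge0.
- set v := a - L / (2 * A) in xx *.
  have -> : A * (a - x) ^+ 2 + L * x - (A * (a - v) ^+ 2 + L * v) =
      A * (x - v) ^+ 2 by rewrite /v; field.
  by rewrite mulr_gt0// lt_def sqrf_eq0 subr_eq0 xx sqr_ge0.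
Qed.

End quadratic_minimum.

(** The bound v <= 1 makes the value v of sin^2 attainable; injectivity of sin on [-pi/2, pi/2] then
    leaves only the two opposite angles. *)
Lemma constant_minimizers_sin2 {R : realType} (F : (R -> R) -> R) (phi : R -> R)
    (v : R) :
  (forall s, F (cst s) = phi (sin s ^+ 2)) -> 0 <= v <= 1 ->
  (forall x, 0 <= x -> x != v -> phi v < phi x) ->
  constant_minimizers F = [set asin (Num.sqrt v); - asin (Num.sqrt v)].
Proof.
move=> FE /andP[v0 v1] phiv; set al := asin (Num.sqrt v).
have sv : -1 <= Num.sqrt v <= 1.
  apply/andP; split; first by rewrite (le_trans _ (sqrtr_ge0 v)) ?lerN10.
  by rewrite -[leRHS]sqrtr1 ler_wsqrtr.
have alb : - (pi / 2) <= al <= pi / 2 by rewrite asin_geNpi2// asin_lepi2.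
have Nalb : - (pi / 2) <= - al <= pi / 2 by rewrite lerN2 lerNl andbC.
have sal : sin al = Num.sqrt v by rewrite asinK// in_itv.
have sal2 : sin al ^+ 2 = v by rewrite sal sqr_sqrtr.
have phi_min c : phi v <= phi (sin c ^+ 2).
  by have [->//|cv] := eqVneq (sin c ^+ 2) v; rewrite ltW// phiv ?sqr_ge0.
apply/seteqP; split => c /=.
  move=> [cb /(_ _ alb)]; rewrite !FE sal2 => phic.
  have /eqP : sin c ^+ 2 = sin al ^+ 2.
    rewrite sal2; apply/eqP; apply: contraTT phic => cv.
    by rewrite -ltNge phiv// sqr_ge0.
  rewrite eqf_sqr -sinN => /orP[] /eqP /sin_inj -> //; rewrite ?in_itv//=.
  - by left.
  - by right.
by move=> [] ->; split => // c' _; rewrite !FE ?sinN ?sqrrN sal2.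
Qed.

(** * Thresholds and optimal angle in the original constants *)

Theorem proposition12 (R : realType)
    (h p sigma d k1 lambda1 lambda2 f theta0 q : R) (n0 : nat)
    (h_gt0 : 0 < h) (p_gt0 : 0 < p) (sigmaE : sigma = 2 * pi / p)
    (k1_gt0 : 0 < k1) (lambda1_gt0 : 0 < lambda1) (lambda2_gt0 : 0 < lambda2)
    (f_gt0 : 0 < f) (theta0_bounds : 0 < theta0 < pi / 2)
    (n0_gt0 : (0 < n0)%N) (qE : q = 2 * pi * n0%:R / h) :
  let F (t : R) (theta : R -> R) : R :=
    energy k1 sigma d f lambda1 lambda2 theta0 q h theta
      (fun z => t * sin (q * z)) in
  let t1 : R :=
    Num.sqrt (k1 * sigma ^+ 2 / (2 * lambda2 * q ^+ 4 * cos theta0 ^+ 2)) in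
  let t2 : R :=
    Num.sqrt (2 * q * h * (k1 * sigma ^+ 2) /
      ((2 * q * h - sin (2 * q * h)) * lambda2 * q ^+ 4 * cos theta0 ^+ 2)) in
  [/\ forall t : R, 0 <= t -> critical_point h (F t) (cst 0),
      forall t : R, 0 <= t -> t < t1 -> zero_stable h (F t),
      forall t : R, 0 <= t -> t2 < t -> zero_unstable h (F t) &
      forall t : R, 0 <= t ->
        constant_minimizers (F t) =
          [set theta_opt k1 sigma lambda2 theta0 q h t;
               - theta_opt k1 sigma lambda2 theta0 q h t]].
Proof.
move=> F t1 t2.
have q_gt0 : 0 < q by rewrite qE divr_gt0// mulr_gt0 ?mulr_gt0 ?pi_gt0// ltr0n.
have q_neq0 : q != 0 by rewrite gt_eqF.
have sinqh : sin (q * h) = 0.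
  rewrite qE divfK ?gt_eqF// (_ : _ * _ = 0 + pi *+ 2 *+ n0).
    by rewrite (periodicn (@sinD2pi R)) sin0.
  by rewrite add0r -mulr_natr -(mulr_natr pi); ring.
(* Thus [t2] reduces to the square root of k1 sigma^2 / (lambda2 q^4 cos^2 theta0), and the
   correction in [theta_opt] disappears. *)
have sin2qh : sin (2 * q * h) = 0.
  by rewrite -mulrA mulr_natl sin_mulr2n sinqh mulr0 mul0rn.
have sigma_gt0 : 0 < sigma by rewrite sigmaE divr_gt0// mulr_gt0// pi_gt0.
have cos_gt0 : 0 < cos theta0.
  case/andP: theta0_bounds => th0 th1; apply: cos_gt0_pihalf; rewrite th1 andbT.
  by rewrite (lt_trans _ th0)// oppr_lt0 divr_gt0// pi_gt0.
have B_gt0 : 0 < k1 * sigma ^+ 2 by rewrite mulr_gt0// exprn_gt0.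
have lq_gt0 : 0 < lambda2 * q ^+ 4 by rewrite mulr_gt0// exprn_gt0.
have a_gt0 : 0 < cos theta0 ^+ 2 by rewrite exprn_gt0.
have a_le1 : cos theta0 ^+ 2 <= 1.
  by rewrite -real_normK ?num_real// exprn_ile1 ?cos_max.
(* Writing t as a square root turns comparison with [t1] or [t2] into comparison of radicands. *)
split => t t0; have tE : t = Num.sqrt (t ^+ 2) by rewrite sqrtr_sqr ger0_norm.
- exact: critical_point0.
- move=> tt1; apply: zero_stable_modulation => //.
  have D_gt0 : 0 < 2 * lambda2 * q ^+ 4 * cos theta0 ^+ 2.
    by rewrite -(mulrA 2) !mulr_gt0.
  move: tt1; rewrite [in X in X -> _]tE ltr_sqrt ?divr_gt0// ltr_pdivlMr//.
  by rewrite -subr_gt0; congr (0 < _); ring.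
- move=> tt2; apply: zero_unstable_modulation => //.
  have qh_gt0 : 0 < 2 * q * h by rewrite !mulr_gt0.
  have D_gt0 : 0 < 2 * q * h * lambda2 * q ^+ 4 * cos theta0 ^+ 2.
    by rewrite -(mulrA _ lambda2) !mulr_gt0.
  have t_gt0 : 0 < t by apply: le_lt_trans tt2; exact: sqrtr_ge0.
  move: tt2; rewrite [in X in X -> _]tE /t2 sin2qh subr0 ltr_sqrt ?exprn_gt0//.
  rewrite ltr_pdivrMr// -subr_lt0 => tt2; rewrite -(pmulr_rlt0 _ qh_gt0).
  by move: tt2; congr (_ < 0); ring.
- pose C := lambda2 * q ^+ 4 * t ^+ 2.
  have C_ge0 : 0 <= C by rewrite mulr_ge0 ?sqr_ge0// ltW.
  (* With x = sin^2 s, the energy of the constant s is A (cos^2 theta0 - x)^2 + L x up to a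
     constant; the linear term comes from cos^2 s = 1 - x. *)
  pose A := C / 2 * h; pose L := k1 * sigma ^+ 2 * h.
  have A_ge0 : 0 <= A by rewrite !mulr_ge0 ?invr_ge0// ltW.
  have L_gt0 : 0 < L by rewrite mulr_gt0.
  have -> : theta_opt k1 sigma lambda2 theta0 q h t =
      asin (Num.sqrt (clipped_vertex A L (cos theta0 ^+ 2))).
    rewrite /theta_opt sin2qh mul0r subr0 /clipped_vertex.
    (* The degenerate case of the quadratic is exactly the case t = 0 singled out in [theta_opt]. *)
    rewrite (_ : (A == 0) = (t == 0)); last first.
      rewrite (_ : A = lambda2 * q ^+ 4 * (h / 2) * t ^+ 2); last first.
        by rewrite /A /C; ring.
      by rewrite mulf_eq0 sqrf_eq0 gt_eqF// mulr_gt0// divr_gt0.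
    case: eqVneq => // tn0; do 5 f_equal.
    rewrite /A /L /C; field.
    by rewrite q_neq0 tn0 (gt_eqF h_gt0) (gt_eqF lambda2_gt0).
  apply: (constant_minimizers_sin2 _ (fun x =>
    A * (cos theta0 ^+ 2 - x) ^+ 2 + L * x + (int0 h (fun z =>
    d / 2 * (t * sin (q * z)) ^+ 2 + f / 4 * (t * sin (q * z)) ^+ 4) - L))).
  + by move=> s; rewrite /F energy_cst// (cos2sin2 s) /A /L /C; field.
  + rewrite clipped_vertex_ge0 (le_trans (clipped_vertex_le _ _ _ _ _ _) a_le1)//.
    exact: ltW.
  + by move=> x x0 xv; rewrite ltrD2r quadratic_lt// ltW.
Qed.
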